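(* Let $\lambda$ be a nonzero complex number, and let $\sqrt{-\lambda}$ denote a square root of $-\lambda$. (1) The following are all equivalent: (i) $\lambda$ is a relation number. (ii) $\sqrt{-\lambda}$ is a root of $s^{\mathbf n}_{k+1}(t)\in\mathbb Z[t]$ for some $k\ge 1$ and some nonzero integer sequence $\mathbf n=(n_1,\dots,n_k)$. (iii) $\sqrt{-\lambda}$ is a root of $s^{\mathbf n}_{2k}(t)\in\mathbb Z[t]$ for some $k\ge 1$ and some nonzero integer sequence $\mathbf n=(n_1,\dots,n_{2k-1})$. (iv) $\sqrt{-\lambda}$ is a root of $T^{\mathbf n}_{k}(t)\in\mathbb Z[t]$ for some $k\ge 1$ and some nonzero integer sequence $\mathbf n=(n_1,\dots,n_k)$. (v) $\sqrt{-\lambda}$ is a root of $\tilde T^{\mathbf n}_{k}(t)\in\mathbb Z[t]$ for some $k\ge 1$ and some nonzero integer sequence $\mathbf n=(n_1,\dots,n_k)$. (vi) $\sqrt{-\lambda}$ is a root of $\hat T^{\mathbf n}_{k}(t)\in\mathbb Z[t]$ for some $k\ge 1$ and some nonzero integer sequence $\mathbf n=(n_1,\dots,n_k)$. (2) $\lambda$ is a relation number if $\sqrt{-\lambda}$ is a zero of either $v^{\mathbf n}_k(t)$ or $v^{\mathbf n}_k(-t)$ in $\mathbb Z[t]$ for some $k\ge 1$ and some nonzero integer sequence $\mathbf n=(n_1,\dots,n_k)$.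
   Context: For $\lambda\in\mathbb C$ let $G_\lambda\subset SL(2,\mathbb C)$ be the subgroup generated by $X=\begin{pmatrix}1&1\\0&1\end{pmatrix}$ and $Y_\lambda=\begin{pmatrix}1&0\\ \lambda&1\end{pmatrix}$. $\lambda$ is a relation number if $G_\lambda$ is not a free group of rank $2$. A nonzero integer sequence is a sequence all of whose entries are nonzero integers. For an integer sequence $\mathbf n=(n_1,n_2,\dots)$ define $s^{\mathbf n}_0(t)=0$, $s^{\mathbf n}_1(t)=1$, $s^{\mathbf n}_{j+1}(t)=n_j\,t\,s^{\mathbf n}_j(t)-s^{\mathbf n}_{j-1}(t)$ (so $s^{\mathbf n}_{j+1}$ depends only on $n_1,\dots,n_j$). Let $\sigma(\mathbf n)=(n_2,n_3,\dots)$ be the shifted sequence. For $\mathbf n$ and $k\ge1$ define $T^{\mathbf n}_k(t)=s^{\mathbf n}_{k+1}(t)-s^{\mathbf n}_{k-1}(t)$, $\tilde T^{\mathbf n}_k(t)=s^{\mathbf n}_{k+1}(t)-s^{\sigma(\mathbf n)}_{k-1}(t)$, $\hat T^{\mathbf n}_k(t)=s^{\mathbf n}_{k+1}(t)+s^{\sigma(\mathbf n)}_{k-1}(t)$, $v^{\mathbf n}_k(t)=s^{\mathbf n}_{k+1}(t)-s^{\sigma(\mathbf n)}_k(t)$. (Equivalently, $v^{\mathbf n}_k=g_{k+1}$ where $g_0=g_1=1$ and $g_{j+1}=n_j t g_j-g_{j-1}$.) *)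

(* Defs.v *)
From HB Require Import structures.
From mathcomp Require Import all_boot all_order all_algebra.
From mathcomp Require Import classical_sets reals complex.

Set Implicit Arguments.
Unset Strict Implicit.
Unset Printing Implicit Defensive.

Import GRing.Theory.
Local Open Scope ring_scope.

Definition is_subgroup (gT : groupType) (H : set gT) : Prop :=
  [/\ H 1%g, forall x y, H x -> H y -> H (x * y)%g & forall x, H x -> H x^-1%g].

Definition generated (gT : groupType) (S : set gT) : set gT :=
  smallest (@is_subgroup gT) S.

(* The letter (i, false) stands for the i-th generator, (i, true) for its     *)
(* inverse; a word is reduced if no letter is followed by its own inverse.    *)
Definition word (r : nat) := seq ('I_r * bool).

Definition reduced (r : nat) (w : word r) : bool :=
  sorted (fun l l' => l' != (l.1, ~~ l.2)) w.

Definition eval_word (gT : groupType) (r : nat) (a : 'I_r -> gT) (w : word r) : gT :=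
  (\prod_(l <- w) (if l.2 then (a l.1)^-1 else a l.1))%g.

(* The basis is not prescribed: being free of rank r is a property of the     *)
(* group G itself, not of a given generating family.                          *)
Definition free_of_rank (gT : groupType) (r : nat) (G : set gT) : Prop :=
  exists a : 'I_r -> gT,
    (forall i, G (a i)) /\
    (forall g, G g -> exists! w : word r, reduced w /\ eval_word a w = g).

Record SL2 (F : fieldType) := MkSL2 {
  SL2_val :> 'M[F]_2;
  _ : \det SL2_val == 1
}.

Section SL2Group.
Variable F : fieldType.

HB.instance Definition _ := [isSub for @SL2_val F].
HB.instance Definition _ := [Choice of SL2 F by <:].

Fact SL2_one_proof : \det (1 : 'M[F]_2) == 1.
Proof. by rewrite det1. Qed.

Fact SL2_mul_proof (A B : SL2 F) : \det (val A * val B) == 1.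
Proof. by rewrite det_mulmx (eqP (valP A)) (eqP (valP B)) mulr1. Qed.

Fact SL2_inv_proof (A : SL2 F) : \det (val A)^-1 == 1.
Proof. by rewrite det_inv (eqP (valP A)) invr1. Qed.

Definition SL2_one : SL2 F := MkSL2 SL2_one_proof.
Definition SL2_mul (A B : SL2 F) : SL2 F := MkSL2 (SL2_mul_proof A B).
Definition SL2_inv (A : SL2 F) : SL2 F := MkSL2 (SL2_inv_proof A).

Fact SL2_unit (A : SL2 F) : val A \is a GRing.unit.
Proof. by rewrite -[_ \is a _]/(_ \in unitmx) unitmxE (eqP (valP A)) unitr1. Qed.

Fact SL2_mulA : associative SL2_mul.
Proof. by move=> A B C; apply: val_inj; apply: mulrA. Qed.
Fact SL2_mul1 : left_id SL2_one SL2_mul.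
Proof. by move=> A; apply: val_inj; apply: mul1r. Qed.
Fact SL2_mulr1 : right_id SL2_one SL2_mul.
Proof. by move=> A; apply: val_inj; apply: mulr1. Qed.
Fact SL2_mulV : left_inverse SL2_one SL2_inv SL2_mul.
Proof. by move=> A; apply: val_inj; apply: (mulVr (SL2_unit A)). Qed.
Fact SL2_mulrV : right_inverse SL2_one SL2_inv SL2_mul.
Proof. by move=> A; apply: val_inj; apply: (mulrV (SL2_unit A)). Qed.

HB.instance Definition _ := isGroup.Build (SL2 F)
  SL2_mulA SL2_mul1 SL2_mulr1 SL2_mulV SL2_mulrV.

Definition mat22 (a b c d : F) : 'M[F]_2 :=
  \matrix_(i < 2, j < 2)
    (if i == 0 then (if j == 0 then a else b) else (if j == 0 then c else d)).

Fact det_mat22 (a b c d : F) : \det (mat22 a b c d) = a * d - b * c.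
Proof.
rewrite (expand_det_row _ 0) !big_ord_recl big_ord0 /cofactor !det_mx11 !mxE /=.
by rewrite expr0 expr1 mul1r mulN1r mulrN addr0.
Qed.

Fact matX_proof : \det (mat22 1 1 0 1) == 1.
Proof. by rewrite det_mat22 mulr1 mulr0 subr0. Qed.

Fact matY_proof (lam : F) : \det (mat22 1 0 lam 1) == 1.
Proof. by rewrite det_mat22 mulr1 mul0r subr0. Qed.

Definition matX : SL2 F := MkSL2 matX_proof.
Definition matY (lam : F) : SL2 F := MkSL2 (matY_proof lam).

End SL2Group.

Definition G_lambda (R : realType) (lam : R[i]) : set (SL2 R[i]) :=
  generated [set matX R[i]; matY lam]%classic.

Definition relation_number (R : realType) (lam : R[i]) : Prop :=
  ~ free_of_rank 2 (G_lambda lam).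

(* A sequence (n_1, n_2, ...) is a list indexed from 0, so n_j is n`_(j-1);   *)
(* out-of-range entries default to 0, but s_(j+1) only reads n_1, ..., n_j,   *)
(* so the default is never read as long as j is at most the length.          *)
Definition nonzero_seq (n : seq int) : bool := all (fun m => m != 0) n.

Fixpoint s_poly (n : seq int) (j : nat) : {poly int} :=
  match j with
  | 0 => 0
  | 1 => 1
  | (j'.+1 as j1).+1 => n`_j' *: 'X * s_poly n j1 - s_poly n j'
  end.

Definition T_poly (n : seq int) (k : nat) : {poly int} :=
  s_poly n k.+1 - s_poly n k.-1.

Definition Ttilde_poly (n : seq int) (k : nat) : {poly int} :=
  s_poly n k.+1 - s_poly (behead n) k.-1.

Definition That_poly (n : seq int) (k : nat) : {poly int} :=
  s_poly n k.+1 + s_poly (behead n) k.-1.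

Definition v_poly (n : seq int) (k : nat) : {poly int} :=
  s_poly n k.+1 - s_poly (behead n) k.

Definition int_poly_root (A : nzRingType) (p : {poly int}) (z : A) : bool :=
  root (map_poly intr p) z.

(* Main.v *)
(* Put A_x = [[x mu, -1], [1, 0]]. Then A_(n_1) ... A_(n_k) has the entries
   s_(k+1), - s_k in its first row and those of the shifted sequence in its second,
   so each root condition is a condition on one such product. Conjugating by
   diag(mu, 1) turns X^a Y^b into - A_a A_b; hence lambda admits a relation between
   X and Y iff some nonempty product with nonzero indices is 1 or -1. Negating n
   conjugates the product by diag(1, -1), and reversing n as well transposes it,
   up to sign; concatenating such variants passes from any of the conditions to
   any other. That X, Y satisfying a relation cannot generate a
   group which is free on two other elements is the Hopf property of free groups;
   it follows from their residual finiteness by counting homomorphisms to a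
   symmetric group. *)
Require Import Defs.
From mathcomp Require Import all_boot all_order perm all_algebra.
From mathcomp Require Import boolp classical_sets reals complex.
From mathcomp Require Import ring zify.

Set Implicit Arguments.
Unset Strict Implicit.
Unset Printing Implicit Defensive.

Import GRing.Theory.

(** * Words, relations and the Hopf property *)

Section Words.
Local Open Scope group_scope.
Variable r : nat.
Implicit Types (l : 'I_r * bool) (w : word r) (gT hT : groupType).

Definition linv l := (l.1, ~~ l.2).

Definition eval_letter gT (a : 'I_r -> gT) l := if l.2 then (a l.1)^-1 else a l.1.

Lemma eval_letter_inv gT (a : 'I_r -> gT) l :
  eval_letter a (linv l) = (eval_letter a l)^-1.
Proof. by case: l => i [] /=; rewrite /eval_letter /= ?invgK. Qed.

Lemma eval_nil gT (a : 'I_r -> gT) : eval_word a [::] = 1.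
Proof. by rewrite /eval_word big_nil. Qed.

Lemma eval_cons gT (a : 'I_r -> gT) l w :
  eval_word a (l :: w) = eval_letter a l * eval_word a w.
Proof. by rewrite /eval_word big_cons. Qed.

Lemma eval_cat gT (a : 'I_r -> gT) w w' :
  eval_word a (w ++ w') = eval_word a w * eval_word a w'.
Proof. by rewrite /eval_word big_cat. Qed.

Lemma eval_seq1 gT (a : 'I_r -> gT) i : eval_word a [:: (i, false)] = a i.
Proof. by rewrite eval_cons eval_nil mulg1. Qed.

Definition winv w : word r := rev (map linv w).

Lemma eval_winv gT (a : 'I_r -> gT) w : eval_word a (winv w) = (eval_word a w)^-1.
Proof.
elim: w => [|l w IH]; first by rewrite eval_nil invg1.
rewrite /winv /= rev_cons -cats1 eval_cat -/(winv w) IH eval_cons eval_nil mulg1.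
by rewrite eval_letter_inv eval_cons invgM.
Qed.

Lemma reduced_cons l w : reduced (l :: w) -> reduced w.
Proof. exact: path_sorted. Qed.

Lemma reduced_winv w : reduced w -> reduced (winv w).
Proof.
rewrite /reduced /winv rev_sorted sorted_map; apply: sub_sorted => x y /=.
by case: x y => [i b] [j c] /=; apply: contraNneq => -[-> ->]; rewrite negbK.
Qed.

Definition push l w := if w is l' :: w' then
  if l' == linv l then w' else l :: w else [:: l].

Definition reduce w : word r := foldr push [::] w.

Lemma eval_reduce gT (a : 'I_r -> gT) w : eval_word a (reduce w) = eval_word a w.
Proof.
elim: w => //= l w IH; rewrite eval_cons -IH; case: (reduce w) => [|l' w'] //=.
  by rewrite eval_cons.
case: eqP => [->|_]; last by rewrite eval_cons.
by rewrite eval_cons eval_letter_inv mulVKg.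
Qed.

Lemma reduced_reduce w : reduced (reduce w).
Proof.
elim: w => //= l w; case: (reduce w) => [|l' w'] //=.
by case: eqP => [_ /path_sorted|/eqP ne red] //=; rewrite /reduced /= ne.
Qed.

Definition subst (v : 'I_r -> word r) w : word r :=
  flatten [seq if l.2 then winv (v l.1) else v l.1 | l <- w].

Lemma eval_subst gT (a : 'I_r -> gT) v w :
  eval_word a (subst v w) = eval_word (fun i => eval_word a (v i)) w.
Proof.
elim: w => [|l w IH]; first by rewrite !eval_nil.
rewrite /subst /= eval_cat -/(subst v w) IH eval_cons; congr (_ * _).
by rewrite /eval_letter; case: l.2; rewrite ?eval_winv.
Qed.

Lemma eq_eval gT (a b : 'I_r -> gT) w : a =1 b -> eval_word a w = eval_word b w.
Proof. by move=> e; apply: eq_bigr => l _; rewrite e. Qed.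

Lemma is_subgroup_eval gT (a : 'I_r -> gT) :
  is_subgroup [set g | exists w, eval_word a w = g]%classic.
Proof.
split=> [|_ _ [u <-] [v <-]|_ [u <-]] /=.
- by exists [::]; rewrite eval_nil.
- by exists (u ++ v); rewrite eval_cat.
- by exists (winv u); rewrite eval_winv.
Qed.

Lemma subgroup_eval gT (H : set gT) (a : 'I_r -> gT) w :
  is_subgroup H -> (forall i, H (a i)) -> H (eval_word a w).
Proof.
case=> H1 HM HV Ha; elim: w => [|l w IH]; first by rewrite eval_nil.
by rewrite eval_cons; apply: HM => //; rewrite /eval_letter; case: l.2; auto.
Qed.

Lemma is_subgroup_generated gT (S : set gT) : is_subgroup (generated S).
Proof.
split=> [H [[]]|x y Gx Gy H HH|x Gx H HH] //.
  by case: HH (Gx _ HH) (Gy _ HH) => [[? HM ?] ?] /=; apply: HM.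
by case: HH (Gx _ HH) => [[? ? HV] ?] /=; apply: HV.
Qed.

Lemma generated_eval gT (S : set gT) (a : 'I_r -> gT) :
  S = (range a)%classic -> generated S = (range (eval_word a))%classic.
Proof.
move=> ->; apply/seteqP; split=> [g|_ [w _ <-]].
  move=> /(_ [set g | exists w, eval_word a w = g]%classic) [].
    split; first exact: is_subgroup_eval.
    by move=> _ [i _ <-]; exists [:: (i, false)]; rewrite eval_seq1.
  by move=> w <-; exists w.
apply: subgroup_eval => [|i H [_ sH]]; first exact: is_subgroup_generated.
by apply: sH; exists i.
Qed.

Definition relation gT (a : 'I_r -> gT) w : Prop :=
  [/\ w <> [::], reduced w & eval_word a w = 1].

(** Common first letters cancel. Once the first letters of [w] and [w'] differ, the inverse of [w']
    followed by [w] is reduced and nonempty, so equal values would make it a relation. *)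
Lemma reduced_eval_inj gT (a : 'I_r -> gT) : ~ (exists w, relation a w) ->
  forall w w', reduced w -> reduced w' -> eval_word a w = eval_word a w' -> w = w'.
Proof.
move=> norel; have triv u : reduced u -> eval_word a u = 1 -> u = [::].
  by move=> ru eu; apply: contrapT => nu; apply: norel; exists u.
elim=> [|l w IH] [|l' w'] // rw rw'; rewrite ?eval_nil => e.
- by rewrite [RHS]triv.
- by rewrite [LHS]triv.
case: (eqVneq l l') e => [->|ne] e.
  congr (_ :: _); apply: IH; [exact: reduced_cons rw|exact: reduced_cons rw'|].
  by move: e; rewrite !eval_cons => /mulgI.
have := triv (winv (l' :: w') ++ l :: w).
rewrite eval_cat eval_winv e mulVg.
have -> : reduced (winv (l' :: w') ++ l :: w).
  move: (reduced_winv rw'); rewrite /winv /= rev_cons cat_rcons.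
  move=> ru; rewrite /reduced sorted_cat_cons; apply/andP; split=> //=.
  by rewrite negbK -surjective_pairing ne.
by move=> /(_ isT erefl) /(congr1 size); rewrite size_cat /= addnS.
Qed.

Lemma free_of_no_relation gT (a : 'I_r -> gT) :
  ~ (exists w, relation a w) -> free_of_rank r (range (eval_word a))%classic.
Proof.
move=> norel; exists a; split=> [i|_ [w _ <-]].
  by exists [:: (i, false)]; rewrite ?eval_seq1.
exists (reduce w); split; first by rewrite reduced_reduce eval_reduce.
move=> w' [rw' e]; apply: (reduced_eval_inj norel) => //.
  exact: reduced_reduce.
by rewrite e eval_reduce.
Qed.

(** The pairs form the graph of a partial injection. A permutation fitting the earlier pairs is
    corrected at a new one by a transposition of its actual and wanted values; injectivity keeps
    this from moving earlier values. *)
Lemma perm_extension (T : finType) (s : seq (T * T)) :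
  {in s &, forall p q, (p.1 == q.1) = (p.2 == q.2)} ->
  exists g : {perm T}, {in s, forall p, g p.1 = p.2}.
Proof.
elim: s => [|p s IH] inj_s; first by exists 1.
have [|g gE] := IH.
  by move=> u v us vs; apply: inj_s; rewrite inE ?us ?vs orbT.
exists (g * tperm (g p.1) p.2) => q; rewrite inE permM.
case/predU1P=> [->|qs]; first by rewrite tpermL.
have := inj_s p q (mem_head _ _); rewrite inE qs orbT => /(_ isT).
case: (eqVneq p.1 q.1) => [<- /esym/eqP <-|ne /esym/negbT ne2].
  by rewrite tpermL.
by rewrite (gE q) // tpermD // -(gE q) // (inj_eq perm_inj).
Qed.

(* The letters of w are realised as the edges j -> j+1 of a path with vertices
   0, ..., size w; reducedness makes the edges of each generator a partial
   injection, and the path leads the vertex 0 to the vertex size w <> 0. *)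
Lemma reduced_perm_neq1 w : w <> [::] -> reduced w ->
  exists a : 'I_r -> {perm 'I_(size w).+1}, eval_word a w <> 1.
Proof.
case: w => // l0 w0 _; set w := l0 :: w0; set N := size w => rw.
pose L j := nth l0 w j.
have redL j : (j.+1 < N)%N -> L j.+1 != linv (L j).
  by move=> jN; apply: (sortedP l0 rw).
(* The edge is oriented along the generator: for an inverse letter the generator itself sends j+1
   back to j. *)
pose src j := (j + (L j).2)%N; pose tgt j := (j + ~~ (L j).2)%N.
have edge_inj j k : (k < N)%N -> (j < k)%N -> (L j).1 = (L k).1 ->
    (src j != src k) && (tgt j != tgt k).
  move=> kN jk ejk; rewrite /src /tgt.
  (* Edges that are not consecutive share no vertex. Consecutive edges of one generator have the
     same sign by reducedness, so sources and targets are both shifted by 1. *)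
  have [ek|nk] := eqVneq k j.+1; last first.
    by case: (L j).2 (L k).2 => [] []; lia.
  have := redL j; rewrite -ek => /(_ kN).
  rewrite [L k]surjective_pairing xpair_eqE -ejk eqxx /=.
  by case: (L j).2 (L k).2 => [] [] // _; lia.
have srcN j : (j < N)%N -> (src j <= N)%N by rewrite /src; case: (L j).2; lia.
have tgtN j : (j < N)%N -> (tgt j <= N)%N by rewrite /tgt; case: (L j).2; lia.
have [a aE] : exists a : 'I_r -> {perm 'I_N.+1},
    forall j, (j < N)%N -> a (L j).1 (inord (src j)) = inord (tgt j).
  suff H i : exists g : {perm 'I_N.+1},
      forall j, (j < N)%N -> (L j).1 = i -> g (inord (src j)) = inord (tgt j).
    exists (fun i => projT1 (cid (H i))) => j jN.
    by case: cid => g /= ->.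
  have [|g gE] := @perm_extension _ [seq (inord (src j) : 'I_N.+1, inord (tgt j) : 'I_N.+1)
      | j <- iota 0 N & (L j).1 == i].
    move=> _ _ /mapP[j + ->] /mapP[k + ->].
    rewrite !mem_filter !mem_iota /= !add0n => /andP[/eqP ji jN] /andP[/eqP ki kN].
    rewrite -!val_eqE /= !inordK ?ltnS ?srcN ?tgtN //.
    case: (ltngtP j k) => [jk|kj|->]; last by rewrite !eqxx.
      by have /andP[/negbTE-> /negbTE->] := edge_inj _ _ kN jk (etrans ji (esym ki)).
    rewrite eq_sym [in RHS]eq_sym.
    by have /andP[/negbTE-> /negbTE->] := edge_inj _ _ jN kj (etrans ki (esym ji)).
  exists g => j jN ji; apply: (gE (_, _)).
  apply: (map_f (fun j => (inord (src j) : 'I_N.+1, inord (tgt j) : 'I_N.+1))).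
  by rewrite mem_filter ji eqxx mem_iota.
exists a => e1.
have walk m : (m <= N)%N -> eval_word a (drop (N - m) w) (inord (N - m)) = inord N.
  elim: m => [_|m IH mN].
    by rewrite subn0 drop_size eval_nil perm1.
  have jN : (N - m.+1 < N)%N by lia.
  have -> : drop (N - m.+1) w = L (N - m.+1)%N :: drop (N - m) w.
    by rewrite (drop_nth l0) // subnSK.
  rewrite eval_cons permM -[RHS]IH ?(ltnW mN) //; apply: congr1.
  rewrite -(subnSK mN) /eval_letter; have := aE _ jN; rewrite /src /tgt.
  case: (L _).2; rewrite /= ?addn0 addn1 // => <-; exact: permK.
have := walk N (leqnn N); rewrite subnn drop0 e1 perm1 => /(congr1 val).
by rewrite /= !inordK.
Qed.

(* Substitution of the words v expressing the generators c in the basis acts on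
   the finite set Hom(F_r, S) of r-tuples of permutations. It is injective since
   the basis is in turn a word in c, hence bijective; so every r-tuple of
   permutations satisfies the relations of c. *)
Theorem free_generators_no_relation gT (c : 'I_r -> gT) :
  free_of_rank r (range (eval_word c))%classic -> ~ exists w, relation c w.
Proof.
case=> a [aG afree] [w [w0 rw w1]].
(* Words with equal values in the basis [a] have the same reduced form, so their equality persists
   under any assignment into any group. *)
have same_eval u u' : eval_word a u = eval_word a u' ->
    forall hT (b : 'I_r -> hT), eval_word b u = eval_word b u'.
  move=> e hT b; rewrite -[LHS]eval_reduce -[RHS]eval_reduce; congr (eval_word b _).
  have Gu : (range (eval_word c))%classic (eval_word a u).
    have [v va] : {v : 'I_r -> word r | forall i, eval_word c (v i) = a i}.
      by exists (fun i => projT1 (cid2 (aG i))) => i; case: cid2.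
    exists (subst v u) => //; rewrite eval_subst; apply: eq_eval; exact: va.
  have [x [_ xu]] := afree _ Gu.
  rewrite -(xu (reduce u)) ?(xu (reduce u')) //;
  by rewrite reduced_reduce eval_reduce.
have [v vc] : {v : 'I_r -> word r | forall i, eval_word a (v i) = c i}.
  suff H i : exists v, eval_word a v = c i.
    by exists (fun i => projT1 (cid (H i))) => i; case: cid.
  have [|x [[_ <-] _]] := afree (c i); last by exists x.
  by exists [:: (i, false)]; rewrite ?eval_seq1.
have [u ua] : {u : 'I_r -> word r | forall i, eval_word c (u i) = a i}.
  by exists (fun i => projT1 (cid2 (aG i))) => i; case: cid2.
have [t tw] := reduced_perm_neq1 w0 rw; apply: tw.
pose S := {perm 'I_(size w).+1}.
pose Phi x (f : {ffun 'I_r -> S}) : {ffun 'I_r -> S} := [ffun i => eval_word f (x i)].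
have PhiK : cancel (Phi v) (Phi u).
  move=> f; apply/ffunP => i; rewrite ffunE.
  rewrite (eq_eval _ (b := fun i => eval_word f (v i))); last by move=> j; rewrite ffunE.
  rewrite -eval_subst -[RHS](eval_seq1 f); apply: same_eval.
  by rewrite eval_subst (eq_eval _ vc) ua eval_seq1.
have [g gt] : exists g : {ffun 'I_r -> S}, forall i, eval_word g (v i) = t i.
  exists (Phi u (finfun t)) => i.
  (* On a finite set a left inverse is also a right inverse, so [Phi u] of the tuple [t] is a
     preimage of [t] under [Phi v]. *)
  have := canF_sym PhiK (finfun t) => /ffunP/(_ i).
  by rewrite !ffunE.
rewrite -(eq_eval _ gt) -eval_subst -[RHS](eval_nil g); apply: same_eval.
by rewrite eval_subst (eq_eval _ vc) w1 eval_nil.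
Qed.

End Words.

(** * Products of continuant matrices *)

Section Continuants.
Local Open Scope ring_scope.
Variable F : fieldType.
Implicit Types (M : 'M[F]_2) (n m : seq int).

Lemma mat22_eta M : M = mat22 (M 0 0) (M 0 1) (M 1 0) (M 1 1).
Proof.
apply/matrixP => i j; rewrite mxE.
by case: (splitP (m := 1) i) => i' /= ei; case: (splitP (m := 1) j) => j' /= ej;
  rewrite -!val_eqE /= ei ej !ord1 /=; congr (M _ _); apply: val_inj => /=; rewrite ?ei ?ej ?ord1.
Qed.

Lemma mat22E (a b c d : F) :
  (mat22 a b c d 0 0 = a) * (mat22 a b c d 0 1 = b) *
  (mat22 a b c d 1 0 = c) * (mat22 a b c d 1 1 = d).
Proof. by rewrite !mxE. Qed.

Lemma mat22_mul (a b c d a' b' c' d' : F) : mat22 a b c d * mat22 a' b' c' d' =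
  mat22 (a * a' + b * c') (a * b' + b * d') (c * a' + d * c') (c * b' + d * d').
Proof.
by rewrite [LHS]mat22_eta; congr (mat22 _ _ _ _);
  rewrite mxE !big_ord_recl big_ord0 addr0 !mxE.
Qed.

Lemma mat22_scale (k a b c d : F) : k *: mat22 a b c d = mat22 (k * a) (k * b) (k * c) (k * d).
Proof. by rewrite [LHS]mat22_eta !mxE. Qed.

Lemma mat22_1 : 1 = mat22 1 0 0 1 :> 'M[F]_2.
Proof. by rewrite [LHS]mat22_eta !mxE. Qed.

Lemma mat22_N1 : - 1 = mat22 (- 1) 0 0 (- 1) :> 'M[F]_2.
Proof. by rewrite -scaleN1r mat22_1 mat22_scale !mulr0 mulr1. Qed.

Variable t : F.

Definition cmx (x : int) : 'M[F]_2 := mat22 (x%:~R * t) (- 1) 1 0.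

Definition cprod n : 'M[F]_2 := \prod_(x <- n) cmx x.

Lemma cprod_nil : cprod [::] = 1.
Proof. by rewrite /cprod big_nil. Qed.

Lemma cprod_cons x n : cprod (x :: n) = cmx x * cprod n.
Proof. by rewrite /cprod big_cons. Qed.

Lemma cprod_cat n m : cprod (n ++ m) = cprod n * cprod m.
Proof. by rewrite /cprod big_cat. Qed.

Lemma cprod_rcons n x : cprod (rcons n x) = cprod n * cmx x.
Proof. by rewrite -cats1 cprod_cat cprod_cons cprod_nil mulr1. Qed.

Lemma det_cprod n : \det (cprod n) = 1.
Proof.
elim: n => [|x n IH]; first by rewrite cprod_nil det1.
by rewrite cprod_cons det_mulmx IH det_mat22; ring.
Qed.

(** With D = diag(1, -1), each [cmx x] is fixed by M -> D M^T D, a map that reverses products. *)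
Lemma cprod_rev n : cprod (rev n) =
  mat22 (cprod n 0 0) (- cprod n 1 0) (- cprod n 0 1) (cprod n 1 1).
Proof.
elim: n => [|x n IH]; first by rewrite cprod_nil mat22_1 !mat22E !oppr0.
rewrite rev_cons cprod_rcons cprod_cons IH [cprod n]mat22_eta.
by rewrite !mat22_mul !mat22E; congr mat22; ring.
Qed.

(** With D = diag(1, -1), conjugating [cmx x] by D gives [- cmx (- x)]; the signs accumulate along
    the product. *)
Lemma cprod_opp n : cprod (map -%R n) = (- 1) ^+ size n *:
  mat22 (cprod n 0 0) (- cprod n 0 1) (- cprod n 1 0) (cprod n 1 1).
Proof.
elim: n => [|x n IH]; first by rewrite cprod_nil mat22_1 !mat22E expr0 scale1r !oppr0.
rewrite /= !cprod_cons IH [cprod n]mat22_eta mat22_scale.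
by rewrite /cmx !mat22_mul !mat22E mat22_scale exprS rmorphN; congr mat22; ring.
Qed.

Definition s_val n j : F := (map_poly intr (s_poly n j)).[t].

Lemma s_val0 n : s_val n 0 = 0.
Proof. by rewrite /s_val rmorph0 horner0. Qed.

Lemma s_val1 n : s_val n 1 = 1.
Proof. by rewrite /s_val rmorph1 hornerC. Qed.

Lemma s_valSS n j : s_val n j.+2 = (n`_j)%:~R * t * s_val n j.+1 - s_val n j.
Proof.
rewrite /s_val [s_poly n j.+2]/= rmorphB rmorphM /= map_polyZ map_polyX /=.
by rewrite !hornerE.
Qed.

(** Right multiplication by [cmx x] carries out the three-term recursion on the first row. *)
Lemma s_val_take n j : (j <= size n)%N ->
  cprod (take j n) 0 0 = s_val n j.+1 /\ cprod (take j n) 0 1 = - s_val n j.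
Proof.
elim: j => [_|j IH jn].
  by rewrite take0 cprod_nil mat22_1 !mat22E s_val0 s_val1 oppr0.
have [e0 e1] := IH (ltnW jn).
rewrite (take_nth 0) // cprod_rcons [cprod _]mat22_eta mat22_mul !mat22E e0 e1 s_valSS.
by split; ring.
Qed.

Lemma cprod00 n : cprod n 0 0 = s_val n (size n).+1.
Proof. by case: (s_val_take (leqnn (size n))); rewrite take_size. Qed.

Lemma cprod01 n : cprod n 0 1 = - s_val n (size n).
Proof. by case: (s_val_take (leqnn (size n))); rewrite take_size. Qed.

Lemma cprod10 n : n != [::] -> cprod n 1 0 = s_val (behead n) (size n).
Proof.
case: n => // x n _; rewrite cprod_cons [cprod n]mat22_eta mat22_mul mat22E.
by rewrite mul1r mul0r addr0 cprod00.
Qed.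

Lemma cprod11 n : n != [::] -> cprod n 1 1 = - s_val (behead n) (size n).-1.
Proof.
case: n => // x n _; rewrite cprod_cons [cprod n]mat22_eta mat22_mul mat22E.
by rewrite mul1r mul0r addr0 cprod01.
Qed.

(** * Passing between conditions by concatenating variants of a sequence *)

Definition nzseq n := (n != [::]) && nonzero_seq n.

Lemma nonzero_cat n m : nonzero_seq (n ++ m) = nonzero_seq n && nonzero_seq m.
Proof. exact: all_cat. Qed.

Lemma nonzero_rev n : nonzero_seq (rev n) = nonzero_seq n.
Proof. exact: all_rev. Qed.

Lemma nonzero_opp n : nonzero_seq (map -%R n) = nonzero_seq n.
Proof. by rewrite /nonzero_seq all_map; apply: eq_all => x /=; rewrite oppr_eq0. Qed.

Lemma nonzero_cons x n : nonzero_seq (x :: n) = (x != 0) && nonzero_seq n.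
Proof. by []. Qed.

Lemma nonzero_rcons n x : nonzero_seq (rcons n x) = (x != 0) && nonzero_seq n.
Proof. exact: all_rcons. Qed.

Definition nonzeroE :=
  (nonzero_cat, nonzero_cons, nonzero_rcons, nonzero_rev, nonzero_opp).

(* cprod (- rev n) is up to sign the transpose P^T of P = cprod n; if P 0 0 = 0,
   then P * cmx x * P^T is J times a unipotent matrix, linearly in x, with
   J = cmx 0, so the effects of x and - x cancel. *)
Definition sandwich n x := n ++ x :: map -%R (rev n).

Lemma cprod_sandwich n x : cprod n 0 0 = 0 ->
  cprod (sandwich n x) = (- 1) ^+ size n *:
    mat22 0 (- 1) 1 (cprod n 1 0 ^+ 2 * (x%:~R * t)).
Proof.
move=> n0; rewrite cprod_cat cprod_cons cprod_opp cprod_rev size_rev !mat22E n0.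
have := det_cprod n; rewrite [cprod n]mat22_eta det_mat22 n0 !mat22E.
set b := cprod n 0 1; set c := cprod n 1 0; set d := cprod n 1 1 => bc.
have {}bc : b * c = - 1 by rewrite -bc; ring.
rewrite /cmx !mat22_scale !mat22_mul; congr mat22.
- by ring.
- by transitivity ((- 1) ^+ size n * (b * c)); [|rewrite bc]; ring.
- by transitivity (- (- 1) ^+ size n * (b * c)); [|rewrite bc]; ring.
- by ring.
Qed.

Definition s_root := exists2 n, nzseq n & cprod n 0 0 = 0.
Definition scalar_rel := exists2 n, nzseq n & cprod n = 1 \/ cprod n = - 1.

Lemma nzseq_nonzero n : nonzero_seq n -> n != [::] -> nzseq n.
Proof. by rewrite /nzseq => -> ->. Qed.

(** A sandwich with parameter x followed by [cmx y] is, up to a sign independent of x and y, lower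
    unipotent with corner additive in (x, y). The blocks for (1, 1) and (-1, -1) therefore cancel,
    sign included. *)
Lemma s_root_even_rel : s_root ->
  exists n, [/\ nzseq n, ~~ odd (size n) & cprod n = 1].
Proof.
case=> n /andP[_ nn] n0.
exists (sandwich n 1 ++ 1 :: sandwich n (- 1) ++ [:: - 1]); split.
- apply: nzseq_nonzero; first by rewrite !nonzeroE nn.
  by case: n {nn n0}.
- by rewrite !size_cat /= !size_cat /= size_map size_rev; lia.
rewrite cprod_cat cprod_cons cprod_cat cprod_cons cprod_nil mulr1 !cprod_sandwich //.
rewrite /cmx !mat22_scale !mat22_mul mat22_1 rmorphN rmorph1.
have := sqrr_sign F (size n); move: ((- 1) ^+ size n) => s s2.
congr mat22; [rewrite -[RHS]s2; ring|ring|ring|rewrite -[RHS]s2; ring].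
Qed.

Lemma s_root_scalar_rel : s_root -> scalar_rel.
Proof. by case/s_root_even_rel=> n [nn _ n1]; exists n; [|left]. Qed.

(** The (0, 1) entry of [cprod n * cmx x] is [- cprod n 0 0], so dropping the last index of a scalar
    product leaves a root. Passing through a relation of even length first makes the remaining
    length odd. *)
Lemma even_rel_odd_s_root : scalar_rel ->
  exists k n, [/\ (1 <= k)%N, size n = (2 * k - 1)%N, nonzero_seq n & cprod n 0 0 = 0].
Proof.
have key n x : nonzero_seq (rcons n x) -> cprod (rcons n x) = 1 \/ cprod (rcons n x) = -1 ->
    n != [::] /\ cprod n 0 0 = 0.
  move=> _; rewrite cprod_rcons [cprod n]mat22_eta mat22_mul !mat22E => e.
  have n0 : cprod n 0 0 = 0.
    by case: e => /(congr1 (fun M : 'M_2 => - (M 0 1))); rewrite ?mat22_N1 ?mat22_1 /= !mat22E oppr0 => <-; ring.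
  split=> //; apply/eqP => en; move: n0; rewrite en cprod_nil mat22_1 mat22E.
  by apply/eqP; rewrite oner_eq0.
case=> n /andP[n0 nn] rn.
have : s_root.
  case/lastP: n n0 nn rn => // n x _ nn /(key _ _ nn)[n0 e].
  by exists n => //; rewrite /nzseq n0; move: nn; rewrite nonzero_rcons => /andP[].
case/s_root_even_rel=> {n0 nn rn}n [].
case/lastP: n => // n x /andP[_ nn]; rewrite size_rcons /= negbK => on e.
have [n0 e0] := key _ _ nn (or_introl e).
exists (size n).+1./2, n; split=> //; try by lia.
by move: nn; rewrite nonzero_rcons => /andP[].
Qed.

Lemma s_root_trace0 : s_root -> exists2 n, nzseq n & cprod n 0 0 + cprod n 1 1 = 0.
Proof.
case=> n /andP[_ nn] n0.
(* The separating indices 1, 1, -2 sum to 0, and so do the sandwich parameters 1, -1, 1, -1. The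
   unipotent parts cancel and leave the quarter turn up to sign, whose trace is 0. *)
exists (sandwich n 1 ++ 1 :: sandwich n (- 1) ++ 1 :: sandwich n 1 ++ - 2%:Z :: sandwich n (- 1)).
  by apply: nzseq_nonzero; [rewrite !nonzeroE nn | case: n {nn n0}].
rewrite 6!(cprod_cat (sandwich _ _) (_ :: _), cprod_cons) !cprod_sandwich //.
rewrite /cmx !mat22_scale !mat22_mul !mat22E.
by ring.
Qed.

(** By Cayley-Hamilton, a matrix of trace 0 and determinant 1 squares to -1. *)
Lemma trace0_scalar_rel n : nzseq n -> cprod n 0 0 + cprod n 1 1 = 0 -> scalar_rel.
Proof.
case/andP=> n0 nn e; exists (n ++ n).
  by apply: nzseq_nonzero; [rewrite nonzero_cat nn | case: n n0 {nn e}].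
right; have := det_cprod n; rewrite cprod_cat [cprod n]mat22_eta det_mat22 mat22_mul.
move/eqP: e; rewrite addr_eq0 => /eqP ->; move: (cprod n 1 1) => d dE.
by rewrite mat22_N1 -dE; congr mat22; ring.
Qed.

(** For determinant 1 and equal diagonal entries, conjugation by diag(1, -1) gives the inverse; up
    to sign, negating the indices performs this conjugation. *)
Lemma eq_diag_scalar_rel n : nzseq n -> cprod n 0 0 = cprod n 1 1 -> scalar_rel.
Proof.
case/andP=> n0 nn e; exists (n ++ map -%R n).
  apply: nzseq_nonzero; [by rewrite nonzero_cat nonzero_opp nn | by case: n n0 {nn e}].
have := det_cprod n; rewrite cprod_cat cprod_opp [cprod n]mat22_eta det_mat22 !mat22E.
rewrite e mat22_scale mat22_mul; move: (cprod n 1 1) (cprod n 0 1) (cprod n 1 0) => a b c d1.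
have H (k : F) : mat22 (a * (k * a) + b * (k * - c)) (a * (k * - b) + b * (k * a))
     (c * (k * a) + a * (k * - c)) (c * (k * - b) + a * (k * a)) = k *: 1.
  by rewrite mat22_1 mat22_scale; congr mat22; [rewrite -d1| | |rewrite -d1]; ring.
rewrite H -signr_odd; case: odd; rewrite ?expr0 ?expr1 ?scale1r ?scaleN1r; [by right|by left].
Qed.

(** The (0, 0) entry for the palindrome with centre x is [cprod n 0 0] times the expression assumed
    to vanish. *)
Lemma palindrome_s_root n x : nonzero_seq (rcons n x) ->
  x%:~R * t * cprod n 0 0 + 2 * cprod n 0 1 = 0 -> s_root.
Proof.
rewrite nonzero_rcons => /andP[x0 nn] e.
exists (n ++ x :: rev n).
  apply: nzseq_nonzero; last by case: n {nn e}.
  by rewrite !nonzeroE nn x0.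
rewrite cprod_cat cprod_cons cprod_rev [cprod n]mat22_eta !mat22_mul !mat22E.
rewrite -[RHS](mulr0 (cprod n 0 0)) -[in RHS]e; ring.
Qed.

(** For [rev n ++ n] the (0, 0) entry is the difference of the two squares. *)
Lemma rev_cat_s_root n : nzseq n ->
  cprod n 0 0 ^+ 2 = cprod n 1 0 ^+ 2 -> s_root.
Proof.
case/andP=> n0 nn e; exists (rev n ++ n).
  apply: nzseq_nonzero; first by rewrite nonzero_cat nonzero_rev nn.
  by rewrite -size_eq0 size_cat addn_eq0 negb_and !size_eq0 n0 orbT.
rewrite cprod_cat cprod_rev [X in _ * X]mat22_eta mat22_mul mat22E.
by rewrite -expr2 e; ring.
Qed.

End Continuants.

(** * Words in X and Y *)

Section LambdaWords.
Local Open Scope ring_scope.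
Variables (F : fieldType) (lam t : F).
Hypotheses (t_neq0 : t != 0) (t_sqr : t ^+ 2 = - lam).
Implicit Types (i : 'I_2) (x : int) (n : seq int) (w : word 2).

Lemma ord2P i : i = 0 \/ i = 1.
Proof. by case: i => [[|[|//]]] ?; [left|right]; apply: val_inj. Qed.

Definition XY i : SL2 F := if i == 0 then matX F else matY lam.

Lemma range_XY : [set matX F; matY lam]%classic = range XY.
Proof.
apply/seteqP; split=> [_ [->|->]|_ [i _ <-]].
- by exists 0.
- by exists 1.
by rewrite /XY; case: eqP; [left|right].
Qed.

(* Conjugation by diag(t, 1) takes X to U t and Y to J (U t) J^-1, where
   U t = [[1, t], [0, 1]] and J is the quarter turn; moreover cmx x = U (x t) J. *)
Definition quarter : 'M[F]_2 := mat22 0 (- 1) 1 0.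

Definition dilate : 'M[F]_2 := mat22 t 0 0 1.

Definition shear i x : 'M[F]_2 :=
  if i == 0 then mat22 1 (x%:~R * t) 0 1 else mat22 1 0 (- (x%:~R * t)) 1.

Lemma shear0 i : shear i 0 = 1.
Proof. by rewrite /shear mat22_1 mul0r oppr0 if_same. Qed.

Lemma shearD i x y : shear i (x + y) = shear i x * shear i y.
Proof. by rewrite /shear; case: eqP => _; rewrite mat22_mul rmorphD; congr mat22; ring. Qed.

Definition wprod w : 'M[F]_2 := \prod_(l <- w) shear l.1 (if l.2 then - 1 else 1).

Lemma wprod_cons l w : wprod (l :: w) = shear l.1 (if l.2 then - 1 else 1) * wprod w.
Proof. by rewrite /wprod big_cons. Qed.

Lemma dilate_unit : dilate \is a GRing.unit.
Proof.
by rewrite -[_ \is a _]/(_ \in unitmx) unitmxE det_mat22 mulr1 mul0r subr0 unitfE.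
Qed.

Lemma dilate_eval w : dilate * val (eval_word XY w) = wprod w * dilate.
Proof.
have gen i : dilate * val (XY i) = shear i 1 * dilate.
  rewrite /XY /shear; case: eqP => _; rewrite /= !mat22_mul; congr mat22; try ring.
  have -> : lam = - t ^+ 2 by rewrite t_sqr opprK.
  by ring.
elim: w => [|l w IH]; first by rewrite eval_nil /wprod big_nil mulr1 mul1r.
rewrite eval_cons wprod_cons -mulrA -IH /= !mulrA; congr (_ * _).
rewrite /eval_letter; case: l.2; last exact: gen.
apply: (mulIr (SL2_unit (XY l.1))).
rewrite -mulrA (mulVr (SL2_unit _)) mulr1 -mulrA gen mulrA -shearD.
by rewrite addNr shear0 mul1r.
Qed.

Lemma eval_eq1 w : eval_word XY w = 1%g <-> wprod w = 1.
Proof.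
have e := dilate_eval w; split=> [w1|w1].
  by apply: (mulIr dilate_unit); rewrite -e w1 mul1r; apply: mulr1.
by apply/val_inj/(mulrI dilate_unit); rewrite e w1 mul1r; apply/esym/mulr1.
Qed.

Lemma quarterX2 : quarter ^+ 2 = - 1.
Proof. by rewrite expr2 mat22_mul mat22_N1; congr mat22; ring. Qed.

Lemma shear_cmx (x : int) : mat22 1 (x%:~R * t) 0 1 * quarter = cmx t x.
Proof. by rewrite mat22_mul; congr mat22; ring. Qed.

Lemma shear_cmx1 (x : int) : mat22 1 0 (- (x%:~R * t)) 1 = - (quarter * cmx t x).
Proof. by rewrite mat22_mul -scaleN1r mat22_scale; congr mat22; ring. Qed.

Lemma shear_quarter i x : shear i x * quarter ^+ i = quarter ^+ i * shear 0 x.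
Proof.
case: (ord2P i) => ->; first by rewrite expr0 mulr1 mul1r.
by rewrite /shear /= expr1 !mat22_mul; congr mat22; ring.
Qed.

Lemma shear_cmxD i x y : shear i x * (quarter ^+ i * cmx t y) = quarter ^+ i * cmx t (x + y).
Proof.
rewrite mulrA shear_quarter -mulrA; congr (_ * _).
by rewrite /shear /cmx mat22_mul rmorphD; congr mat22; ring.
Qed.

(** The power k is 0 or 2, so [quarter ^+ k] is 1 or -1; being central, this sign can be moved to
    the far right, past any [M]. *)
Lemma shear_switch i j x : i != j -> exists k, forall M,
  shear i x * (quarter ^+ j * M) = quarter ^+ i * (cmx t x * (M * quarter ^+ k)).
Proof.
case: (ord2P i) (ord2P j) => -> [] -> // _.
  by exists 0 => M; rewrite /shear /= expr0 mul1r mulr1 expr1 mulrA shear_cmx.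
exists 2 => M; rewrite /shear /= shear_cmx1 quarterX2 expr0 expr1 mul1r.
by rewrite !mulrN !mulr1 mulNr mulrA.
Qed.

(** Each maximal run of one generator becomes a single index, its signed length. Recording the sign
    of the leading index ensures that prepending a letter to its run cannot produce 0, since
    reducedness makes the signs agree. *)
Lemma reduced_wprod l w : reduced (l :: w) ->
  exists x n k, [/\ x != 0, (x < 0) = l.2, nonzero_seq n &
    wprod (l :: w) = quarter ^+ l.1 * cprod t (x :: n) * quarter ^+ k].
Proof.
pose sg (b : bool) : int := if b then - 1 else 1.
elim: w l => [|l' w IH] l.
  move=> _; exists (sg l.2), [::].
  (* No letter follows to supply a power of [quarter] for the switch, so 1 is split as
     [quarter ^+ j * quarter ^+ (4 - j)]. *)
  have [j nj] : exists j : 'I_2, l.1 != j by case: (ord2P l.1) => ->; [exists 1 | exists 0].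
  have [k kE] := shear_switch (sg l.2) nj.
  have [q qE] : exists q, quarter ^+ j * quarter ^+ q = 1.
    exists (4 - j)%N; rewrite -exprD subnKC; last by case: j {nj kE} => [[|[|]]].
    by rewrite (exprM quarter 2 2) quarterX2 sqrrN expr1n.
  exists (q + k)%N; split; rewrite // /sg; try by case: l.2.
  rewrite /wprod big_seq1 cprod_cons cprod_nil mulr1 -[shear _ _]mulr1 -qE kE.
  by rewrite exprD !mulrA.
rewrite /reduced /= => /andP[ne rw].
have [x [n [k [x0 xl' nn e]]]] := IH l' rw.
have [el|nl] := eqVneq l.1 l'.1.
  have ell : l.2 = l'.2.
    move: ne; rewrite [l']surjective_pairing xpair_eqE el eqxx /=.
    by case: l.2 l'.2 => [] [].
  exists (sg l.2 + x), n, k; split=> //.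
  - by move: x0 xl'; rewrite ell /sg; case: l'.2; lia.
  - by move: x0 xl'; rewrite ell /sg; case: l'.2; lia.
  rewrite wprod_cons e cprod_cons [in LHS]el !mulrA -[shear _ _ * _ * _]mulrA shear_cmxD.
  by rewrite el cprod_cons !mulrA.
have [q qE] := shear_switch (sg l.2) nl.
exists (sg l.2), (x :: n), (k + q)%N; split; rewrite ?nonzero_cons ?x0 //; try by rewrite /sg; case: l.2.
by rewrite wprod_cons e -mulrA qE !cprod_cons exprD !mulrA.
Qed.

(** A relation makes P = [cprod t (x :: n)] inverse to a power of [quarter]. As [quarter] squares to
    -1, P squares to 1 or -1, whence the doubled sequence. *)
Lemma relation_scalar_rel : (exists w, relation XY w) -> scalar_rel t.
Proof.
case=> -[|l w] [] // _ rw /eval_eq1; have [x [n [k [x0 _ nn ->]]]] := reduced_wprod rw.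
move=> e; have Junit : quarter \is a GRing.unit.
  by rewrite -[_ \is a _]/(_ \in unitmx) unitmxE det_mat22 mulr0 mulN1r opprK add0r unitr1.
pose P := cprod t (x :: n).
have PJ : P * quarter ^+ (k + l.1) = 1.
  rewrite exprD mulrA; apply: (mulrI (unitrX l.1 Junit)).
  by rewrite !mulrA [_ * P * _]e mul1r mulr1.
exists ((x :: n) ++ x :: n).
  by apply: nzseq_nonzero; rewrite // !nonzeroE x0 nn.
have comm : P ^+ 2 * (quarter ^+ 2) ^+ (k + l.1) = 1.
  rewrite -exprM mulnC exprM; move: (quarter ^+ _) PJ => Q PQ.
  by rewrite !expr2 mulrA -(mulrA P P) PQ mulr1.
rewrite cprod_cat -/P -expr2.
move: comm; rewrite quarterX2 -signr_odd; case: odd; rewrite ?expr1 ?expr0 ?mulr1 ?mulrN1.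
  by move=> /(congr1 -%R); rewrite opprK; right.
by left.
Qed.

(** * From nonzero sequences back to reduced words *)

Definition syllable i x : word 2 := nseq `|x|%N (i, (x < 0)%R).

(** This is X^x Y^y X^z ... with the entries as exponents. An unpaired last entry is dropped, so
    values are computed for even length only. *)
Fixpoint alternating n : word 2 :=
  if n is x :: y :: n' then syllable 0 x ++ syllable 1 y ++ alternating n' else [::].

Lemma wprod_cat w w' : wprod (w ++ w') = wprod w * wprod w'.
Proof. by rewrite /wprod big_cat. Qed.

Lemma wprod_syllable i x : wprod (syllable i x) = shear i x.
Proof.
have H b m : wprod (nseq m (i, b)) = shear i (if b then - m%:Z else m%:Z).
  elim: m => [|m IH]; first by rewrite oppr0 if_same shear0 /wprod big_nil.
  rewrite [nseq _ _]/= wprod_cons IH -shearD.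
  by case: b {IH} => /=; congr shear; lia.
rewrite /syllable H; congr shear; case: ifP; lia.
Qed.

Lemma reduced_syllable i x w : x != 0 -> reduced w ->
  (if w is l :: _ then l.1 != i else true) -> reduced (syllable i x ++ w).
Proof.
rewrite /syllable -absz_gt0; case: absz => // m _ rw hw; elim: m => [|m IH].
  case: w rw hw => //= l w rw nl; rewrite /reduced /= [path _ _ _]rw andbT.
  by rewrite [l]surjective_pairing xpair_eqE (negbTE nl).
by rewrite /reduced /= xpair_eqE eqxx /= [path _ _ _]IH andbT; case: Order.lt.
Qed.

Lemma reduced_alternating n : nonzero_seq n -> reduced (alternating n).
Proof.
(* Entries are consumed in pairs, so the induction carries two consecutive lengths. *)
suff [//] : (nonzero_seq n -> reduced (alternating n)) /\
  (forall x, nonzero_seq (x :: n) -> reduced (alternating (x :: n))).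
elim: n => [//|x n [IH IH1]]; split; first exact: IH1.
move=> y; rewrite !nonzero_cons => /and3P[y0 x0 nn] /=.
apply: reduced_syllable => //.
  apply: reduced_syllable => //; first exact: IH.
  case: n {IH IH1} nn => [|z [|u n]] //; rewrite nonzero_cons => /andP[z0 _].
  by move: z0; rewrite /= /syllable -absz_gt0; case: absz.
by move: x0; rewrite /syllable -absz_gt0; case: absz.
Qed.

(** Each pair contributes [- (cmx t x * cmx t y)], the minus sign coming from [shear_cmx1]. *)
Lemma wprod_alternating q n : size n = q.*2 ->
  wprod (alternating n) = (- 1) ^+ q * cprod t n.
Proof.
elim: q n => [|q IH] n; first by move/size0nil->; rewrite cprod_nil mulr1 expr0 /wprod big_nil.
case: n => [|x [|y n]] //; rewrite doubleS => -[/IH e].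
rewrite [alternating _]/= !wprod_cat !wprod_syllable e !cprod_cons exprS.
have s1 : (- 1 : 'M[F]_2) ^+ q = 1 \/ (- 1 : 'M[F]_2) ^+ q = - 1.
  by rewrite -signr_odd; case: odd; [right | left].
rewrite [shear 0 x]/shear [shear 1 y]/shear /= shear_cmx1 -(shear_cmx x).
by case: s1 => ->; rewrite !(mul1r, mulr1, mulN1r, mulNr, mulrN, opprK) !mulrA.
Qed.

Lemma scalar_rel_relation : scalar_rel t -> exists w, relation XY w.
Proof.
(* Four copies give an even number [2 * size n] of pairs, so the sign from the alternating word is
   1, as is the fourth power of the scalar. *)
case=> n /andP[n0 nn] e; pose m := (n ++ n) ++ (n ++ n).
exists (alternating m); split.
- rewrite /m; case: n n0 nn {e m} => // x n _; rewrite nonzero_cons => /andP[].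
  rewrite -absz_gt0 => x0 _; case en: ((x :: n) ++ x :: n) => [|y [|z u]] //.
    by move: (congr1 size en); rewrite size_cat /=; lia.
  by move: en => -[<- _] /=; rewrite /syllable; case: absz x0.
- by apply: reduced_alternating; rewrite !nonzeroE nn.
apply/eval_eq1; rewrite (@wprod_alternating (2 * size n)).
  rewrite !cprod_cat exprM sqrrN expr1n !expr1n mul1r.
  by case: e => ->; rewrite ?mulrNN !mulr1.
by rewrite /m !size_cat; lia.
Qed.

(** Without a relation X and Y are themselves a basis. The converse must exclude every other basis
    as well, which is where the Hopf property enters. *)
Lemma free_scalar_rel : ~ free_of_rank 2 (generated [set matX F; matY lam]%classic) <->
  scalar_rel t.
Proof.
rewrite (generated_eval range_XY); split=> [nfree|/scalar_rel_relation rel free].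
  by apply: relation_scalar_rel; apply: contrapT => /free_of_no_relation.
exact: free_generators_no_relation free rel.
Qed.

End LambdaWords.

(** * Root conditions as conditions on the entries of a product *)

Section RootConditions.
Local Open Scope ring_scope.
Variables (F : fieldType) (t : F).

Lemma int_poly_rootE p : int_poly_root p t <-> (map_poly intr p).[t] = 0.
Proof. by split=> /rootP. Qed.

Definition tuple_root (Q : seq int -> nat -> {poly int}) := exists (k : nat) (n : k.-tuple int),
  [/\ (1 <= k)%N, nonzero_seq n & int_poly_root (Q n k) t].

Lemma tuple_rootP Q : tuple_root Q <->
  exists2 n, nzseq n & (map_poly intr (Q n (size n))).[t] = 0.
Proof.
split=> [[k [n [k1 nn /int_poly_rootE r]]]|[n /andP[n0 nn] r]].
  exists n; last by rewrite size_tuple.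
  by rewrite /nzseq nn -size_eq0 size_tuple -lt0n k1.
exists (size n), (in_tuple n); split=> //; last exact/int_poly_rootE.
by rewrite lt0n size_eq0.
Qed.

Lemma tuple_root_s : tuple_root (fun n k => s_poly n k.+1) <-> s_root t.
Proof.
by rewrite tuple_rootP; split=> -[n nn r]; exists n => //; move: r; rewrite cprod00.
Qed.

(** Both [s_(k+1)] and [- s_(k-1)] contribute [cprod t m 0 1], hence the factor 2; the result is the
    expression of [palindrome_s_root]. *)
Lemma T_val (m : seq int) (x : int) :
  (map_poly intr (T_poly (rcons m x) (size m).+1)).[t] =
  x%:~R * t * cprod t m 0 0 + 2 * cprod t m 0 1.
Proof.
have := @s_val_take F t (rcons m x) (size m); rewrite size_rcons leqnSn => /(_ isT)[_].
rewrite -cats1 take_size_cat // cats1 => e.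
transitivity (s_val t (rcons m x) (size m).+2 - s_val t (rcons m x) (size m)).
  by rewrite /T_poly rmorphB hornerD hornerN.
have := cprod00 t (rcons m x); rewrite size_rcons => <-.
rewrite cprod_rcons [cprod t m in LHS]mat22_eta mat22_mul mat22E e.
ring.
Qed.

Lemma tuple_root_T : tuple_root T_poly -> s_root t.
Proof.
move/tuple_rootP=> [n]; case/lastP: n => // n x /andP[_ nn].
by rewrite size_rcons T_val; apply: palindrome_s_root.
Qed.

(** Doubling the last index turns the value of [T_poly] into twice the value of [s_(k+1)] for the
    original sequence. *)
Lemma s_root_tuple_root_T : s_root t -> tuple_root T_poly.
Proof.
case=> n; case/lastP: n => // n x /andP[_ nn] r.
apply/tuple_rootP; exists (rcons n (2 * x)).
  by apply: nzseq_nonzero; [move: nn; rewrite !nonzeroE; lia | case: n {nn r}].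
rewrite size_rcons T_val -[RHS](mulr0 2) -r.
rewrite cprod_rcons [cprod t n in RHS]mat22_eta mat22_mul mat22E rmorphM.
by ring.
Qed.

Lemma Ttilde_val n : nzseq n ->
  (map_poly intr (Ttilde_poly n (size n))).[t] = cprod t n 0 0 + cprod t n 1 1.
Proof.
by case/andP=> n0 _; rewrite cprod00 cprod11 // /Ttilde_poly rmorphB hornerD hornerN.
Qed.

Lemma That_val n : nzseq n ->
  (map_poly intr (That_poly n (size n))).[t] = cprod t n 0 0 - cprod t n 1 1.
Proof.
by case/andP=> n0 _; rewrite cprod00 cprod11 // /That_poly rmorphD hornerD opprK.
Qed.

Lemma v_val n : nzseq n ->
  (map_poly intr (v_poly n (size n))).[t] = cprod t n 0 0 - cprod t n 1 0.
Proof.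
by case/andP=> n0 _; rewrite cprod00 cprod10 // /v_poly rmorphB hornerD hornerN.
Qed.

Lemma tuple_root_v : tuple_root v_poly -> s_root t.
Proof.
case/tuple_rootP=> n nn; rewrite v_val // => /eqP; rewrite subr_eq0 => /eqP e.
by apply: (rev_cat_s_root nn); rewrite e.
Qed.

End RootConditions.

(** * The cycle of equivalences and the sufficient condition *)

Local Open Scope ring_scope.

Theorem theoremA (R : realType) (lam mu : R[i])
    (lam_neq0 : lam <> 0) (mu_sqrt : mu ^+ 2 = - lam) :
  [<-> relation_number lam;
       exists (k : nat) (n : k.-tuple int),
         [/\ (1 <= k)%N, nonzero_seq n & int_poly_root (s_poly n k.+1) mu];
       exists (k : nat) (n : (2 * k - 1).-tuple int),
         [/\ (1 <= k)%N, nonzero_seq n & int_poly_root (s_poly n (2 * k)) mu];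
       exists (k : nat) (n : k.-tuple int),
         [/\ (1 <= k)%N, nonzero_seq n & int_poly_root (T_poly n k) mu];
       exists (k : nat) (n : k.-tuple int),
         [/\ (1 <= k)%N, nonzero_seq n & int_poly_root (Ttilde_poly n k) mu];
       exists (k : nat) (n : k.-tuple int),
         [/\ (1 <= k)%N, nonzero_seq n & int_poly_root (That_poly n k) mu]]
  /\
  ((exists (k : nat) (n : k.-tuple int),
      [/\ (1 <= k)%N, nonzero_seq n &
          int_poly_root (v_poly n k) mu \/
          int_poly_root (v_poly n k \Po (- 'X)) mu]) ->
   relation_number lam).
Proof.
(* Both square roots of [- lam] are covered, since the condition on v(-t) leads to [- mu]. *)
have relP (t : R[i]) : t ^+ 2 = - lam -> relation_number lam <-> scalar_rel t.
  move=> t2; apply: free_scalar_rel => //; apply/eqP => t0; apply: lam_neq0.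
  by rewrite -[lam]opprK -t2 t0 expr0n oppr0.
split.
  tfae.
  - move/(relP _ mu_sqrt)/even_rel_odd_s_root=> [k [n [k1 sn nn n0]]].
    apply/tuple_root_s; exists n => //; apply: nzseq_nonzero => //.
    by rewrite -size_eq0 sn; lia.
  - move/tuple_root_s/s_root_scalar_rel/even_rel_odd_s_root.
    case=> k [n [k1 sn nn n0]]; exists k, (tcast sn (in_tuple n)).
    rewrite val_tcast; split=> //; apply/int_poly_rootE => /=; move: n0.
    by rewrite cprod00 sn (_ : (2 * k - 1).+1 = 2 * k)%N //; lia.
  - case=> k [n [k1 nn r]]; apply: s_root_tuple_root_T; apply/tuple_root_s.
    exists (2 * k - 1)%N, n; split=> //; first by lia.
    by rewrite (_ : (2 * k - 1).+1 = 2 * k)%N //; lia.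
  - move/tuple_root_T/s_root_trace0=> [n nn e].
    by apply/tuple_rootP; exists n; rewrite ?Ttilde_val.
  - move/tuple_rootP=> [n nn]; rewrite Ttilde_val // => /(trace0_scalar_rel nn)[m nm e].
    apply/tuple_rootP; exists m; rewrite // That_val //.
    (* A product equal to 1 or -1 has equal diagonal entries, so [That_poly] vanishes for it. *)
    by case: e => ->; rewrite ?mat22_N1 ?mat22_1 !mat22E subrr.
  - move/tuple_rootP=> [n nn]; rewrite That_val // => /eqP; rewrite subr_eq0 => /eqP e.
    by apply/(relP _ mu_sqrt); apply: eq_diag_scalar_rel nn e.
case=> k [n [k1 nn [r|r]]].
  apply/(relP _ mu_sqrt)/s_root_scalar_rel/tuple_root_v.
  by exists k, n.
apply/(relP (- mu)); first by rewrite sqrrN.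
apply/s_root_scalar_rel/tuple_root_v; exists k, n; split=> //.
move/int_poly_rootE: r => r; apply/int_poly_rootE; rewrite -r.
by rewrite map_comp_poly rmorphN /= map_polyX horner_comp hornerN hornerX.
Qed.
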